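(* Let $(X,\mu,T)$ be an infinite-measure-preserving, conservative, ergodic dynamical system on a $\sigma$-finite measure space, let $L_0\subseteq X$ be a measurable set with $0<\mu(L_0)<\infty$, and let $\{L_k\}_{k\in\mathbb{N}}$ be the partition of $X$ (mod $\mu$) defined recursively by $$L_k := \left(T^{-1}L_{k-1}\right)\setminus L_0,\qquad k\ge 1 .$$ Let $f\in L^\infty(X,\mu)$ (complex-valued) admit $f^*\in\mathbb{C}$ with the following property: for every $\varepsilon>0$ there exist $N,K\in\mathbb{N}$, with $N\ge 1$, such that for all $x\in\bigcup_{k\ge K}L_k$, $$\left|\mathcal{A}_N f(x)-f^*\right|\le\varepsilon .$$ Then, for $\mu$-a.e. $x\in X$, the limit $\mathcal{A}f(x)=\lim_{n\to\infty}\mathcal{A}_nf(x)$ exists and $\mathcal{A}f(x)=f^*$.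
   Context: $\mathbb{N}=\{0,1,2,\dots\}$. A dynamical system $(X,\mu,T)$ consists of a measurable space $X$, a $\sigma$-finite measure $\mu$ on it, and a measurable map $T:X\to X$ (not necessarily invertible) preserving $\mu$, i.e. $\mu(T^{-1}A)=\mu(A)$ for all measurable $A$. It is infinite-measure-preserving if $\mu(X)=\infty$. $T$ is ergodic if every measurable $B$ with $T^{-1}B=B$ mod $\mu$ (equality up to a $\mu$-null set) satisfies $\mu(B)=0$ or $\mu(X\setminus B)=0$. $T$ is conservative if Poincaré recurrence holds: for every measurable set $A$, a.e. point of $A$ returns to $A$ under iteration of $T$. For $f:X\to\mathbb{C}$ and a positive integer $n$, $$\mathcal{A}_nf(x):=\frac1n\sum_{k=0}^{n-1}f(T^k(x)),\qquad \mathcal{A}f(x):=\lim_{n\to\infty}\mathcal{A}_nf(x)\ \text{ whenever the limit exists.}$$ The set $L_k$ is the set of points whose orbit $x,T(x),T^2(x),\dots$ intersects $L_0$ for the first time at the $k$-th iteration; by conservativity and ergodicity the $L_k$ form a partition of $X$ mod $\mu$. *)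

(* Defs.v *)
From HB Require Import structures.
From mathcomp Require Import all_boot all_order all_algebra.
From mathcomp Require Import complex.
From mathcomp Require Import all_classical all_reals all_analysis.

Set Implicit Arguments.
Unset Strict Implicit.
Unset Printing Implicit Defensive.

Import Order.TTheory GRing.Theory Num.Theory.
Import numFieldNormedType.Exports.

Local Open Scope classical_set_scope.
Local Open Scope ring_scope.
Local Open Scope complex_scope.

Section dynamics.
Context {d : measure_display} {X : measurableType d} {R : realType}.
Variables (mu : {measure set X -> \bar R}) (T : X -> X).

Definition measure_preserving : Prop :=
  measurable_fun setT T /\
  forall A : set X, measurable A -> mu (T @^-1` A) = mu A.

Definition ergodic : Prop :=
  forall B : set X, measurable B -> mu ((T @^-1` B) `+` B) = 0%E ->
    mu B = 0%E \/ mu (~` B) = 0%E.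

Definition conservative : Prop :=
  forall A : set X, measurable A ->
    {ae mu, forall x, A x -> exists n : nat, (0 < n)%N /\ A (iter n T x)}.

(* [R[i]^o] carries the topology of the norm [`|_|]; measurability is with
   respect to its Borel sigma-algebra. [f] is a genuine function, i.e. a chosen
   representative of its class modulo [mu]-null sets. *)
Definition Linfty_complex (f : X -> R[i]) : Prop :=
  measurable_fun setT
    (f : X -> g_sigma_algebraType (@open (R[i]^o : topologicalType))) /\
  finite_norm mu +oo%E (fun x => complex.Re `|f x|).

End dynamics.

Section levels.
Context {X : Type}.
Variables (T : X -> X) (L0 : set X).

Fixpoint level (k : nat) : set X :=
  if k is k'.+1 then (T @^-1` level k') `\` L0 else L0.

End levels.

(* For [n = 0] this is the junk value [0]. *)
Definition birkhoff_avg {X : Type} {R : realType} (T : X -> X)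
    (f : X -> R[i]) (n : nat) (x : X) : R[i] :=
  n%:R^-1 * \sum_(0 <= k < n) f (iter k T x).

(* Main.v *)
Require Import Defs.
From HB Require Import structures.
From mathcomp Require Import all_boot all_order all_algebra.
From mathcomp Require Import complex.
From mathcomp Require Import all_classical all_reals all_analysis.
From mathcomp Require Import measurable_realfun ess_sup_inf lra.

Import Order.TTheory GRing.Theory Num.Theory.
Import numFieldNormedType.Exports.

Local Open Scope classical_set_scope.
Local Open Scope ring_scope.
Local Open Scope complex_scope.

(** The proof compares Birkhoff averages with averages of block averages.  Fix
    [eps], and let [N], [K] be as in the hypothesis.  Since [f] is bounded, the
    sums of [f] and of [A_N f] along [n] steps of an orbit differ by a quantity
    that does not depend on [n] ([norm_sum_smoothing]).  Now [A_N f] is within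
    [eps] of [fstar] as long as the orbit is outside the bad set [B], the
    complement of the union of the [L_k] with [k >= K], and inside [B] it is
    off by at most a constant.  So everything reduces to showing that a.e.
    orbit spends an asymptotically negligible proportion of its time in [B].

    First, [B] has finite measure.  Up to the points that never meet [L0], it
    is the union of [K] levels, each of measure at most [mu L0] because
    [L_(k+1)] is contained in the preimage of [L_k]; and by conservativity the
    union of all levels is invariant up to a null set, hence conull by
    ergodicity ([levels_cover], [low_levels_finite]).

    Second, in an infinite-measure ergodic system a set [B] of finite measure
    has zero visit frequency ([visits_sublinear]).  For [c > 0] let [V] be the
    set of points whose number of visits to [B] up to time [n], minus [c n], is
    unbounded above.  [V] is invariant, and the maximal ergodic inequality
    gives [c * mu V <= mu B].  So [mu V] is finite, [V] cannot be conull in a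
    space of infinite measure, and ergodicity makes it null. *)

(** * Birkhoff sums of block averages *)

Section shifted_sums.
Context {F : numFieldType}.
Variables (b : nat -> F) (M : F).
Hypothesis b_le : forall k, `|b k| <= M.

Lemma norm_shifted_sum_sub n j :
  `|\sum_(0 <= k < n) b (j + k)%N - \sum_(0 <= k < n) b k| <= (2 * j)%:R * M.
Proof.
elim: j => [|j IHj].
  under eq_bigr do rewrite add0n.
  by rewrite subrr normr0 muln0 mul0r.
have step : \sum_(0 <= k < n) b (j.+1 + k)%N - \sum_(0 <= k < n) b (j + k)%N
    = b (j + n)%N - b j.
  rewrite -sumrB.
  under eq_bigr do rewrite addSnnS.
  by rewrite (@telescope_sumr _ _ _ (fun k => b (j + k)%N)) // addn0.
rewrite -(subrKA (\sum_(0 <= k < n) b (j + k)%N)) step.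
rewrite mulnS natrD mulrDl (le_trans (ler_normD _ _)) // lerD //.
by rewrite (le_trans (ler_normB _ _)) // mulr_natl mulr2n lerD.
Qed.

(** Shifting the window of summation by [j] only alters [2 j] terms, and a sum
    of block averages is an average of shifted sums. *)
Lemma norm_sum_smoothing n N : (0 < N)%N ->
  `|\sum_(0 <= k < n) b k
    - \sum_(0 <= k < n) N%:R^-1 * \sum_(0 <= j < N) b (j + k)%N|
  <= (2 * N)%:R * M.
Proof.
move=> N0; have NF : N%:R != 0 :> F by rewrite pnatr_eq0 -lt0n.
(* The sum of the block averages is the mean over [j < N] of the sums shifted
   by [j]; the unshifted sum is the mean of [N] copies of itself. *)
rewrite -mulr_sumr exchange_big /=.
have -> : \sum_(0 <= k < n) b k =
    N%:R^-1 * \sum_(0 <= j < N) \sum_(0 <= k < n) b k.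
  by rewrite sumr_const_nat subn0 -[X in _ = _ * X]mulr_natl mulKf.
rewrite -mulrBr -sumrB normrM normfV normr_nat.
rewrite ler_pdivrMl ?ltr0n // (le_trans (ler_norm_sum _ _ _)) //.
have -> : N%:R * ((2 * N)%:R * M) = \sum_(0 <= j < N) (2 * N)%:R * M.
  by rewrite sumr_const_nat subn0 mulr_natl.
apply: ler_sum_nat => j /andP[_ jN].
rewrite distrC (le_trans (norm_shifted_sum_sub n j)) //.
apply: ler_wpM2r; first exact: le_trans (normr_ge0 _) (b_le 0).
by rewrite ler_nat leq_mul2l ltnW.
Qed.

End shifted_sums.

(** The weight [w] is meant to be the indicator of the times at which the block
    average is not known to be small. *)
Lemma norm_sum_le_block_averages {F : numFieldType} (b w : nat -> F)
    (M e : F) (N n : nat) :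
  (forall k, `|b k| <= M) -> (0 < N)%N ->
  (forall k, `|N%:R^-1 * \sum_(0 <= j < N) b (j + k)%N| <= e + M * w k) ->
  `|\sum_(0 <= k < n) b k|
    <= (2 * N)%:R * M + n%:R * e + M * \sum_(0 <= k < n) w k.
Proof.
move=> bM N0 avg; have := norm_sum_smoothing b M bM n N N0.
set S := \sum_(0 <= k < n) b k; set S' := \sum_(0 <= k < n) _ => SS'.
rewrite -(subrK S' S) -[X in _ <= X]addrA (le_trans (ler_normD _ _)) // lerD //.
rewrite (le_trans (ler_norm_sum _ _ _)) //.
have -> : n%:R * e + M * \sum_(0 <= k < n) w k
    = \sum_(0 <= k < n) (e + M * w k).
  by rewrite big_split /= sumr_const_nat subn0 mulr_natl mulr_sumr.
by apply: ler_sum => k _.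
Qed.

(** * Number of visits to a set *)

Section visits.
Context {X : Type} {R : realType}.
Variables (T : X -> X) (B : set X).

Definition visits (n : nat) (x : X) : R :=
  \sum_(0 <= k < n) \1_B (iter k T x).

(** This is the maximum of [visits k x - c * k] over [k <= n].  The recursion
    along the orbit is what the proof of the maximal inequality uses. *)
Fixpoint max_excess (c : R) (n : nat) (x : X) : R :=
  if n is n'.+1 then Num.max 0 (\1_B x - c + max_excess c n' (T x)) else 0.

(** The points where [visits n x - c * n] is unbounded above.  This set lies
    between those where the upper frequency of visits is [> c] and [>= c]; it
    replaces them because it needs no limit superior and is exactly
    [T]-invariant. *)
Definition visit_often (c : R) : set X :=
  \bigcap_j \bigcup_n [set x | c * n%:R + j%:R < visits n x].

Lemma visits0 x : visits 0 x = 0.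
Proof. by rewrite /visits big_geq. Qed.

Lemma visitsS n x : visits n.+1 x = \1_B x + visits n (T x).
Proof.
rewrite /visits big_nat_recl //=; congr (_ + _).
by apply: eq_bigr => k _; rewrite -iterSr.
Qed.

Lemma indic01 x : 0 <= (\1_B x : R) <= 1.
Proof. by rewrite indicE; case: (_ \in _); rewrite /= ?ler01 ?lexx. Qed.

Lemma max_excess_ge0 c n x : 0 <= max_excess c n x.
Proof. by case: n => //= n; rewrite le_max lexx. Qed.

Lemma max_excess_nondecreasing c n x :
  max_excess c n x <= max_excess c n.+1 x.
Proof.
elim: n x => [|n IHn] x; first exact: max_excess_ge0.
by rewrite /= ge_max le_max lexx /= le_max lerD2l IHn orbT.
Qed.

Lemma visits_le_max_excess c n x : visits n x - c * n%:R <= max_excess c n x.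
Proof.
elim: n x => [|n IHn] x; first by rewrite visits0 mulr0 subr0.
rewrite /= le_max; apply/orP; right; move: (IHn (T x)).
rewrite visitsS -natr1; lra.
Qed.

(** The pointwise form of the maximal ergodic inequality (Garsia's argument).
    Where the maximum is positive the recursion is an equality; elsewhere the
    left-hand side vanishes. *)
Lemma max_excess_step c n x : 0 <= c ->
  max_excess c n.+1 x + c * \1_[set y | 0 < max_excess c n.+1 y] x
    <= \1_B x + max_excess c n (T x).
Proof.
move=> c0; have := max_excess_ge0 c n (T x); have /andP[] := indic01 x.
rewrite [\1_[set _ | _] x]indicE.
case: (boolP (x \in _)); rewrite /= ?inE ?notin_setE /= ?lt_max ?ltxx /=.
  by move=> h; rewrite max_r ?(ltW h) // mulr1; lra.
by move=> /negP; rewrite -leNgt => h; rewrite max_l // mulr0; lra.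
Qed.

(** Passing from [x] to [T x] changes [visits n x - c * n] by a
    bounded amount. *)
Lemma visit_often_preimage c : 0 <= c -> T @^-1` visit_often c = visit_often c.
Proof.
move=> c0; apply/seteqP; split=> x vx j _ /=.
  have [n _ /= lt_n] := vx (j + Num.bound c)%N I.
  exists n.+1 => //=; rewrite visitsS; have /andP[+ _] := indic01 x.
  by have := archi_boundP c0; move: lt_n; rewrite natrD -natr1; lra.
have [[|n] _ /= lt_n] := vx j.+1 I.
  by move: lt_n; rewrite visits0 mulr0 add0r ltrn0.
exists n => //=; move: lt_n; have /andP[_] := indic01 x.
by rewrite visitsS -!natr1; lra.
Qed.

Lemma visit_often_sub c :
  visit_often c `<=` \bigcup_n [set x | 0 < max_excess c n x].
Proof.
move=> x /(_ 0 I)[n _ /= lt_n]; exists n => //=.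
by have := visits_le_max_excess c n x; lra.
Qed.

End visits.

Section measurable_visits.
Context {d : measure_display} {X : measurableType d} {R : realType}.
Variables (T : X -> X) (B : set X).
Hypotheses (T_meas : measurable_fun setT T) (B_meas : measurable B).

Lemma measurable_iter n : measurable_fun setT (iter n T).
Proof.
elim: n => [|n IHn]; first exact: measurable_id.
exact: (measurableT_comp T_meas IHn).
Qed.

Lemma measurable_visits n : measurable_fun setT (visits T B n : X -> R).
Proof.
apply: measurable_sum => k.
apply: (measurableT_comp _ (measurable_iter k)).
exact: measurable_indic.
Qed.

Lemma measurable_max_excess (c : R) n :
  measurable_fun setT (max_excess T B c n).
Proof.
elim: n => [|n IHn]; first exact: measurable_cst.
apply: measurable_maxr; first exact: measurable_cst.
apply: measurable_funD; last exact: (measurableT_comp IHn T_meas).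
by apply: measurable_funB; [exact: measurable_indic|exact: measurable_cst].
Qed.

Lemma measurable_ltr_set (g h : X -> R) :
  measurable_fun setT g -> measurable_fun setT h ->
  measurable [set x | g x < h x].
Proof.
move=> mg mh.
have := measurable_fun_ltr mg mh measurableT (Logic.I : measurable [set true]).
by rewrite setTI.
Qed.

Lemma measurable_max_excess_gt0 (c : R) n :
  measurable [set x | 0 < max_excess T B c n x].
Proof.
by apply: measurable_ltr_set; [exact: measurable_cst|
  exact: measurable_max_excess].
Qed.

Lemma measurable_visit_often (c : R) : measurable (visit_often T B c).
Proof.
apply: bigcap_measurable; first by exists 0%N.
move=> j _; apply: bigcup_measurable => n _.
by apply: measurable_ltr_set; [exact: measurable_cst|exact: measurable_visits].
Qed.

End measurable_visits.

(** * The maximal inequality and vanishing visit frequencies *)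

Section maximal.
Context {d : measure_display} {X : measurableType d} {R : realType}.
Variables (mu : {measure set X -> \bar R}) (T : X -> X).
Hypothesis T_mp : measure_preserving mu T.

Lemma integral_measure_preserving (g : X -> R) :
  measurable_fun setT g -> (forall x, 0 <= g x) ->
  (\int[mu]_x (g (T x))%:E = \int[mu]_x (g x)%:E)%E.
Proof.
move=> mg g0; case: T_mp => mT muT.
have -> : (\int[mu]_x (g x)%:E = \int[pushforward mu T]_x (g x)%:E)%E.
  by apply: eq_measure_integral => A mA _; rewrite -[LHS]muT.
rewrite (ge0_integral_pushforward mT) ?preimage_setT //.
- exact/measurable_EFinP.
- by move=> x _; rewrite lee_fin.
Qed.

Lemma ae_iter (P : X -> Prop) :
  {ae mu, forall x, P x} -> {ae mu, forall x, forall k, P (iter k T x)}.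
Proof.
move=> [A [mA muA subA]]; apply: ae_foralln => k.
case: T_mp => mT muT.
exists (iter k T @^-1` A); split.
- rewrite -[X in measurable X]setTI; exact: measurable_iter.
- elim: k => [//|k IHk]; rewrite -IHk.
  rewrite (_ : iter k.+1 T @^-1` A = T @^-1` (iter k T @^-1` A)).
    rewrite muT // -[X in measurable X]setTI; exact: measurable_iter.
  by apply/seteqP; split=> x /=; rewrite -iterS iterSr.
- by move=> x nP; apply: subA.
Qed.

Variable B : set X.
Hypotheses (B_meas : measurable B) (B_fin : (mu B < +oo)%E).

Let mexcess (c : R) n : measurable_fun setT (max_excess T B c n).
Proof. by apply: measurable_max_excess => //; exact: T_mp.1. Qed.

(** Integrating the pointwise step, and using that [T] preserves the integral. *)
Lemma integral_max_excess_step c n : 0 <= c ->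
  (\int[mu]_x (max_excess T B c n.+1 x)%:E
     + c%:E * mu [set x | (0 < max_excess T B c n.+1 x)%R]
   <= mu B + \int[mu]_x (max_excess T B c n x)%:E)%E.
Proof.
move=> c0.
set P := [set x | _].
have mP : measurable P by apply: measurable_max_excess_gt0 => //; exact: T_mp.1.
have iP : measurable_fun setT (fun x => (\1_P x : R)%:E).
  by apply/measurable_EFinP; exact: measurable_indic.
have iB : measurable_fun setT (fun x => (\1_B x : R)%:E).
  by apply/measurable_EFinP; exact: measurable_indic.
have iM k : measurable_fun setT (fun x => (max_excess T B c k x)%:E).
  exact/measurable_EFinP/mexcess.
have iMT : measurable_fun setT (fun x => (max_excess T B c n (T x))%:E).
  by apply/measurable_EFinP; exact: (measurableT_comp (mexcess c n) T_mp.1).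
have muE (A : set X) : measurable A -> mu A = (\int[mu]_x (\1_A x)%:E)%E.
  by move=> mA; rewrite integral_indic // setIT.
rewrite (muE P) // (muE B) //.
rewrite -(@integral_measure_preserving (max_excess T B c n)); last 2 first.
- exact: mexcess.
- by move=> x; exact: max_excess_ge0.
have id01 (A : set X) x : (0 <= (\1_A x : R)%:E)%E.
  by rewrite lee_fin; case/andP: (indic01 (R := R) A x).
have M0 k x : (0 <= (max_excess T B c k x)%:E)%E.
  by rewrite lee_fin max_excess_ge0.
rewrite -ge0_integralZl //.
rewrite -!ge0_integralD //; last 2 first.
- by move=> x _; rewrite mule_ge0 // lee_fin.
- by apply: measurable_funeM.
apply: ge0_le_integral => //.
- by move=> x _; rewrite adde_ge0 // mule_ge0 // lee_fin.
- by apply: emeasurable_funD; [exact: iM|exact: measurable_funeM].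
- by apply: emeasurable_funD; [exact: iB|exact: iMT].
- by move=> x _; rewrite -EFinM -!EFinD lee_fin; exact: max_excess_step.
Qed.

Lemma integral_max_excess_lty c n : 0 <= c ->
  (\int[mu]_x (max_excess T B c n x)%:E < +oo)%E.
Proof.
move=> c0; elim: n => [|n IHn].
  by rewrite /= integral0 ltry.
apply: le_lt_trans _ (lte_add_pinfty B_fin IHn).
apply: le_trans _ (integral_max_excess_step c n c0).
by rewrite leeDl // mule_ge0 // lee_fin.
Qed.

(** The maxima increase with [n], so the integrals in the previous step cancel;
    this is where their finiteness matters. *)
Lemma maximal_inequality c n : 0 <= c ->
  (c%:E * mu [set x | (0 < max_excess T B c n x)%R] <= mu B)%E.
Proof.
move=> c0; case: n => [|n].
  rewrite (_ : [set _ | _] = set0) ?measure0 ?mule0 ?measure_ge0 //.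
  by apply/seteqP; split=> x //=; rewrite ltxx.
have I0 k : (0 <= \int[mu]_x (max_excess T B c k x)%:E)%E.
  by apply: integral_ge0 => x _; rewrite lee_fin max_excess_ge0.
have Ifin k : (\int[mu]_x (max_excess T B c k x)%:E \is a fin_num)%E.
  by rewrite ge0_fin_numE // integral_max_excess_lty.
rewrite -(leeD2lE _ _ (Ifin n.+1)).
apply: le_trans (integral_max_excess_step c n c0) _.
rewrite addeC leeD2r //; apply: ge0_le_integral => //.
- by move=> x _; rewrite lee_fin max_excess_ge0.
- exact/measurable_EFinP/mexcess.
- exact/measurable_EFinP/mexcess.
- by move=> x _; rewrite lee_fin max_excess_nondecreasing.
Qed.

(** The bound of the maximal inequality is uniform in [n], so it passes to the
    increasing union of the sets where the maximum is positive. *)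
Lemma visit_often_finite (c : R) : 0 < c -> (mu (visit_often T B c) < +oo)%E.
Proof.
move=> c0; pose P n := [set x | 0 < max_excess T B c n x].
have mP n : measurable (P n).
  by apply: measurable_max_excess_gt0 => //; exact: T_mp.1.
have mU : measurable (\bigcup_n P n) by exact: bigcup_measurable.
have muU : (mu (\bigcup_n P n) <= c^-1%:E * mu B)%E.
  have cvP : mu \o P @ \oo --> mu (\bigcup_n P n).
    apply: nondecreasing_cvg_mu => //; apply/nondecreasing_seqP => n.
    apply/subsetPset => x /= /lt_le_trans; apply.
    exact: max_excess_nondecreasing.
  rewrite -(cvg_lim _ cvP) //; apply: lime_le.
    by apply/cvg_ex; eexists; exact: cvP.
  apply: nearW => n /=; rewrite lee_pdivlMl //.
  by apply: maximal_inequality; exact: ltW.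
apply: (@le_lt_trans _ _ (mu (\bigcup_n P n))).
  apply: le_measure; rewrite ?inE //; last exact: visit_often_sub.
  by apply: measurable_visit_often => //; exact: T_mp.1.
apply: le_lt_trans muU _.
by rewrite lte_mul_pinfty // lee_fin invr_ge0 ltW.
Qed.

(** Infinite measure enters here: the invariant set of finite measure
    [visit_often T B c] cannot be conull. *)
Lemma visits_sublinear : mu setT = +oo%E -> ergodic mu T ->
  forall c : R, 0 < c -> {ae mu, forall x,
    exists j : nat, forall n, visits T B n x <= c * n%:R + j%:R}.
Proof.
move=> muT erg c c0.
have mV : measurable (visit_often T B c).
  by apply: measurable_visit_often => //; exact: T_mp.1.
exists (visit_often T B c); split => //.
  case: (erg _ mV) => [|//|muVC].
    by rewrite visit_often_preimage ?ltW // setYK measure0.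
  have := visit_often_finite c c0.
  suff -> : mu (visit_often T B c) = +oo%E by rewrite ltxx.
  rewrite -muT -(setUv (visit_often T B c)).
  rewrite measureU ?setICr //; last exact: measurableC.
  by rewrite [X in (_ + X)%E]muVC adde0.
move=> x /= /forallNP nx j _; have /existsNP[n /negP] := nx j.
by rewrite -ltNge => lt_n; exists n.
Qed.

End maximal.

(** * The level sets *)

Section levels.
Context {d : measure_display} {X : measurableType d} {R : realType}.
Variables (mu : {measure set X -> \bar R}) (T : X -> X) (L0 : set X).
Hypotheses (T_mp : measure_preserving mu T) (L0_meas : measurable L0).

Let measurable_preimageT A : measurable A -> measurable (T @^-1` A).
Proof. by move=> mA; rewrite -[X in measurable X]setTI; exact: T_mp.1. Qed.

Lemma measurable_level k : measurable (level T L0 k).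
Proof.
by elim: k => [//|k IHk]; apply: measurableD => //; exact: measurable_preimageT.
Qed.

Lemma level_le k : (mu (level T L0 k) <= mu L0)%E.
Proof.
elim: k => [//|k IHk]; apply: le_trans _ IHk.
have mk := measurable_level k.
rewrite -(T_mp.2 _ mk); apply: le_measure; rewrite ?inE.
- exact: (measurable_level k.+1).
- exact: measurable_preimageT.
- by move=> x [].
Qed.

Lemma level_of_preimage x :
  (exists k, level T L0 k (T x)) -> exists k, level T L0 k x.
Proof.
move=> [k Lk]; have [L0x|nL0x] := pselect (L0 x); first by exists 0%N.
by exists k.+1.
Qed.

Lemma level_of_hit n x : L0 (iter n T x) -> exists k, level T L0 k x.
Proof.
elim: n x => [|n IHn] x; first by exists 0%N.
by rewrite iterSr => /IHn; exact: level_of_preimage.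
Qed.

(** The union of the levels contains its preimage, and a point of the union
    whose image is outside must lie in [L0] and never return to it; such points
    form a null set by conservativity.  So ergodicity applies. *)
Lemma levels_cover : conservative mu T -> ergodic mu T -> (0 < mu L0)%E ->
  mu (~` \bigcup_k level T L0 k) = 0%E.
Proof.
move=> cons erg L0_gt0; set H := \bigcup_k _.
have mH : measurable H.
  by apply: bigcup_measurable => k _; exact: measurable_level.
have mTH := measurable_preimageT H mH.
have [||//] := erg H mH.
  (* [A] is a null set containing the points of [L0] that do not return. *)
  have [A [mA muA sA]] := cons L0 L0_meas.
  apply/eqP; rewrite -measure_le0 -muA; apply: le_measure; rewrite ?inE //.
    by apply: measurableU; exact: measurableD.
  move=> x [[THx nHx]|[[k _ Lk] nTHx]].
    exfalso; apply: nHx; case: THx => k _ Lk.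
    by have [|i Li] := level_of_preimage x; [exists k|exists i].
  apply: sA => /=; move: Lk; case: k => [L0x|k [Lk _]] /=; last first.
    by exfalso; apply: nTHx; exists k.
  move=> /(_ L0x)[[|n] [// _ Ln]]; apply: nTHx.
  have {}Ln : L0 (iter n T (T x)) by rewrite -iterSr.
  by have [i Li] := level_of_hit _ _ Ln; exists i.
move=> muH; move: L0_gt0; suff -> : mu L0 = 0%E by rewrite ltxx.
apply/eqP; rewrite -measure_le0 -muH; apply: le_measure; rewrite ?inE //.
by move=> x L0x; exists 0%N.
Qed.

Lemma low_levels_finite K : conservative mu T -> ergodic mu T ->
  (0 < mu L0)%E -> (mu L0 < +oo)%E ->
  (mu (~` \bigcup_(k >= K) level T L0 k) < +oo)%E.
Proof.
move=> cons erg L0_gt0 L0_fin.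
have mU n : measurable (~` \bigcup_(k >= n) level T L0 k).
  apply: measurableC; apply: bigcup_measurable => k _; exact: measurable_level.
elim: K => [|K IHK].
  rewrite (_ : \bigcup_(k >= 0) _ = \bigcup_k level T L0 k) ?levels_cover //.
  by apply: eq_bigcupl; split=> k.
have mK := measurable_level K.
apply: (@le_lt_trans _ _ (mu (~` \bigcup_(k >= K) level T L0 k)
                          + mu (level T L0 K))%E).
  apply: le_trans _ (measureU2 _ (mU K) mK).
  apply: le_measure; rewrite ?inE //; first exact: measurableU.
  move=> x nUx; have [Lx|nLx] := pselect (level T L0 K x); [by right|left].
  move=> [k /= Kk Lk]; apply: nUx; exists k => //=.
  rewrite ltn_neqAle Kk andbT; apply/eqP => eqK.
  by apply: nLx; rewrite eqK.
by apply: lte_add_pinfty => //; exact: le_lt_trans (level_le K) L0_fin.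
Qed.

End levels.

(** * Convergence of the averages *)

Lemma Linfty_complex_ae_bounded {d : measure_display} {X : measurableType d}
    {R : realType} (mu : {measure set X -> \bar R}) (f : X -> R[i]) :
  (0 < mu setT)%E -> Linfty_complex mu f ->
  exists2 M : R, 0 <= M & {ae mu, forall x, `|f x| <= M%:C}.
Proof.
move=> mu0 [_]; rewrite /finite_norm unlock mu0.
set s := ess_sup _ _ => s_fin; exists `|fine s| => //.
have := ess_sup_ge mu (abse \o (EFin \o (fun x => complex.Re `|f x|))).
apply: filterS => x /=; rewrite -/s; move: s s_fin => [r| |] //= _.
rewrite lee_fin => /(le_trans (ler_norm _)) /le_trans /(_ (ler_norm r)).
by rewrite -lecR.
Qed.

Section birkhoff_deviation.
Context {X : Type} {R : realType}.
Variables (T : X -> X) (f : X -> R[i]) (l : R[i]).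

Lemma birkhoff_avg_sub n x : (0 < n)%N ->
  birkhoff_avg T f n x - l = n%:R^-1 * \sum_(0 <= k < n) (f (iter k T x) - l).
Proof.
move=> n0; rewrite sumrB sumr_const_nat subn0 mulrBr -[X in _ - _ * X]mulr_natl.
by rewrite mulKf // pnatr_eq0 -lt0n.
Qed.

(** The estimate along one orbit: of the three [e], the first bounds the block
    averages outside [B], the second the contribution of the visits to [B], and
    the third absorbs the error terms that do not grow with [n]. *)
Lemma birkhoff_avg_close (B : set X) (x : X) (C e : R) (N j : nat) :
  0 < C -> 0 < e -> (0 < N)%N ->
  (forall k, `|f (iter k T x) - l| <= C%:C) ->
  (forall y, ~ B y -> `|birkhoff_avg T f N y - l| <= e%:C) ->
  (forall n, visits T B n x <= e / C * n%:R + j%:R) ->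
  \forall n \near \oo, `|birkhoff_avg T f n x - l| <= (3 * e)%:C.
Proof.
move=> C0 e0 N0 fC avg vis.
(* The part of the error in the sum that does not depend on [n]. *)
pose D : R := (2 * N)%:R * C + C * j%:R.
exists (Num.bound (D / e)).+1 => // n /= ltn.
have n0 : (0 < n)%N by exact: leq_ltn_trans ltn.
have D0 : 0 <= D by rewrite addr_ge0 // mulr_ge0 // ?ler0n // ltW.
have De : D <= e * n%:R.
  rewrite mulrC -ler_pdivrMr //; apply: ltW.
  apply: lt_trans (archi_boundP _) _; first by rewrite divr_ge0 // ltW.
  by rewrite ltr_nat.
rewrite birkhoff_avg_sub // normrM normfV normr_nat ler_pdivrMl ?ltr0n //.
have block k : `|N%:R^-1 * \sum_(0 <= i < N) (f (iter (i + k) T x) - l)|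
    <= e%:C + C%:C * (\1_B (iter k T x) : R)%:C.
  under eq_bigr do rewrite iterD.
  rewrite -(birkhoff_avg_sub N (iter k T x)) // indicE.
  have [Bk|nBk] := pselect (B (iter k T x)).
    rewrite mem_set // mulr1 birkhoff_avg_sub // normrM normfV normr_nat.
    apply: (@le_trans _ _ C%:C); last by rewrite lerDr lecR ltW.
    rewrite ler_pdivrMl ?ltr0n // (le_trans (ler_norm_sum _ _ _)) //.
    have -> : N%:R * C%:C = \sum_(0 <= i < N) C%:C :> R[i].
      by rewrite sumr_const_nat subn0 mulr_natl.
    by apply: ler_sum => i _; rewrite -iterD.
  by rewrite memNset // mulr0 addr0; exact: avg.
have := norm_sum_le_block_averages (fun k => f (iter k T x) - l)
  (fun k => (\1_B (iter k T x))%:C) C%:C e%:C N n fC N0 block.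
move=> /le_trans; apply.
rewrite -rmorph_sum /= -/(visits T B n x) -!(rmorph_nat (real_complex R)).
rewrite -!rmorphM -!rmorphD /= lecR.
have : C * visits T B n x <= e * n%:R + C * j%:R.
  rewrite -ler_pdivlMl // mulrDr mulKf ?gt_eqF // mulrA [C^-1 * e]mulrC.
  exact: vis.
move: De; rewrite /D; lra.
Qed.

End birkhoff_deviation.

Theorem theorem2p5 (d : measure_display) (X : measurableType d) (R : realType)
    (mu : {sigma_finite_measure set X -> \bar R}) (T : X -> X)
    (T_mp : measure_preserving mu T) (mu_infinite : mu setT = +oo%E)
    (T_cons : conservative mu T) (T_erg : ergodic mu T)
    (L0 : set X) (L0_meas : measurable L0)
    (L0_gt0 : (0 < mu L0)%E) (L0_fin : (mu L0 < +oo)%E)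
    (f : X -> R[i]) (f_Linfty : Linfty_complex mu f) (fstar : R[i])
    (f_avg : forall eps : R, 0 < eps ->
      exists N K : nat, (0 < N)%N /\
        forall x : X, (\bigcup_(k >= K) level T L0 k) x ->
          `|birkhoff_avg T f N x - fstar| <= eps%:C) :
  {ae mu, forall x : X,
    (fun n : nat => (birkhoff_avg T f n x : R[i]^o)) @ \oo
      --> (fstar : R[i]^o)}.
Proof.
have mu_gt0 : (0 < mu setT)%E by rewrite mu_infinite.
have [M M_ge0 M_bound] := Linfty_complex_ae_bounded mu f mu_gt0 f_Linfty.
have [nl fstarE] : exists nl : R, `|fstar| = nl%:C.
  by exists (complex.Re `|fstar|); rewrite RRe_real // normr_real.
have nl_ge0 : 0 <= nl by have := normr_ge0 fstar; rewrite fstarE (lecR 0 nl).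
(* [C] bounds [f - fstar] along a.e. orbit; the summand 1 makes it positive even
   when [f] and [fstar] vanish. *)
pose C : R := M + nl + 1.
have C0 : 0 < C by rewrite /C; lra.
have close (e : R) : 0 < e -> {ae mu, forall x, \forall n \near \oo,
    `|birkhoff_avg T f n x - fstar| <= (3 * e)%:C}.
  move=> e0; have [N [K [N0 avg]]] := f_avg e e0.
  set B := ~` \bigcup_(k >= K) level T L0 k.
  have mB : measurable B.
    apply: measurableC; apply: bigcup_measurable => k _.
    exact: (measurable_level mu).
  have B_fin : (mu B < +oo)%E by exact: low_levels_finite.
  have sub := visits_sublinear mu T T_mp B mB B_fin mu_infinite T_erg
    (e / C) (divr_gt0 e0 C0).
  have := ae_iter mu T T_mp _ M_bound.
  apply: filterS2 sub => x [j vis] fM.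
  apply: (birkhoff_avg_close T f fstar B x C e N j) => //.
    move=> k; rewrite (le_trans (ler_normB _ _)) //.
    by rewrite fstarE (le_trans (lerD (fM k) (lexx _))) // -rmorphD lecR lerDl.
  by move=> y nB; apply: avg; apply: contrapT.
have : {ae mu, forall x, forall p : nat, \forall n \near \oo,
    `|birkhoff_avg T f n x - fstar| <= (3 * p.+1%:R^-1)%:C}.
  by apply: ae_foralln => p; apply: close; rewrite invr_gt0.
apply: filterS => x close_x; apply/cvgrPdist_le => eps eps_gt0.
have eps_real : (complex.Re eps)%:C = eps by rewrite RRe_real // gtr0_real.
have Re_gt0 : 0 < complex.Re eps by rewrite -ltcR eps_real.
have [p p_le] : exists p, 3 * p.+1%:R^-1 <= complex.Re eps.
  exists (Num.bound (3 / complex.Re eps)).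
  rewrite ler_pdivrMr // mulrC -ler_pdivrMr //; apply: ltW.
  apply: lt_trans (archi_boundP _) _; first by rewrite divr_ge0 // ltW.
  by rewrite ltr_nat.
have := close_x p; apply: filterS => n /= le_n.
by rewrite distrC (le_trans le_n) // -eps_real lecR.
Qed.
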